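(* An override restriction category is precisely an update restriction category. That is, let $\mathbb{X}$ be a restriction category. If $\triangleright$ is an override operator on $\mathbb{X}$, then $\mathbb{X}$ has binary joins and $f\diamond g:=\overline{f}(g\triangleright f)$ defines an update operator on $\mathbb{X}$. If $\mathbb{X}$ has binary joins and $\diamond$ is an update operator on $\mathbb{X}$, then $f\triangleright g:=(g\diamond f)\vee f$ defines an override operator on $\mathbb{X}$. These two constructions are inverse to each other.
   Context: Composition is written diagrammatically: for $f:A\to B$ and $g:B\to C$, $fg:A\to C$ is $f$ followed by $g$. Composition binds more tightly than all other binary operations. A restriction category is a category $\mathbb{X}$ equipped with operations $\overline{(-)}:\mathbb{X}(A,B)\to\mathbb{X}(A,A)$ for all objects $A,B$ such that: [R.1] $\overline{f}f=f$ for $f\in\mathbb{X}(A,B)$; [R.2] $\overline{f}\,\overline{g}=\overline{g}\,\overline{f}$ for $f\in\mathbb{X}(A,B)$, $g\in\mathbb{X}(A,C)$; [R.3] $\overline{\overline{f}g}=\overline{f}\,\overline{g}$ for $f\in\mathbb{X}(A,B)$, $g\in\mathbb{X}(A,C)$; [R.4] $f\overline{g}=\overline{fg}f$ for $f\in\mathbb{X}(A,B)$, $g\in\mathbb{X}(B,C)$. For $f,g\in\mathbb{X}(A,B)$: $f\le g$ means $\overline{f}g=f$ (this is a partial order on each homset); $f\smile g$ ($f$ and $g$ are compatible) means $\overline{g}f=\overline{f}g$. A restriction category has binary joins if for all $f,g\in\mathbb{X}(A,B)$ with $f\smile g$ there is a map $f\vee g\in\mathbb{X}(A,B)$ such that: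 [J.1] $f\le f\vee g$ and $g\le f\vee g$; [J.2] for any $h\in\mathbb{X}(A,B)$, if $f\le h$ and $g\le h$ then $f\vee g\le h$; [J.3] for any $k\in\mathbb{X}(A',A)$, $k(f\vee g)=kf\vee kg$. Joins are unique when they exist. An override restriction category is a restriction category $\mathbb{X}$ with binary operations $\triangleright:\mathbb{X}(A,B)\times\mathbb{X}(A,B)\to\mathbb{X}(A,B)$ for all objects $A,B$ (an override operator) such that: (1) $(f\triangleright g)\triangleright h=f\triangleright(g\triangleright h)$ for $f,g,h\in\mathbb{X}(A,B)$; (2) $f\triangleright\overline{f}g=f$ for $f,g\in\mathbb{X}(A,B)$; (3) $\overline{g}f\triangleright f=f$ for $f\in\mathbb{X}(A,B)$, $g\in\mathbb{X}(A,C)$; (4) $f(g\triangleright h)=fg\triangleright fh$ for $f\in\mathbb{X}(A,B)$, $g,h\in\mathbb{X}(B,C)$; (5) $\overline{f\triangleright g}\,h=\overline{f}h\triangleright\overline{g}h$ for $f,g\in\mathbb{X}(A,C)$, $h\in\mathbb{X}(A,B)$. An update restriction category is a restriction category $\mathbb{X}$ that has binary joins together with binary operations $\diamond:\mathbb{X}(A,B)\times\mathbb{X}(A,B)\to\mathbb{X}(A,B)$ for all objects $A,B$ (an update operator) such that: (U1) $f(g\diamond h)=fg\diamond fh$ for $f\in\mathbb{X}(A,B)$, $g,h\in\mathbb{X}(B,C)$; (U2) $\overline{f\diamond g}=\overline{f}$ for $f,g\in\mathbb{X}(A,B)$; (U3) $\overline{f}g\diamond f=\overline{g}f$ for $f,g\in\mathbb{X}(A,B)$;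 (U4) $\overline{g}h\diamond\overline{f}h=\overline{g}h$ for $f\in\mathbb{X}(A,B)$, $g\in\mathbb{X}(A,C)$, $h\in\mathbb{X}(A,D)$; (U5) $(((h\diamond g)\vee g)\diamond f)\vee f=(h\diamond((g\diamond f)\vee f))\vee((g\diamond f)\vee f)$ for $f,g,h\in\mathbb{X}(A,B)$. (Axioms (U1)-(U3) imply $(g\diamond f)\smile f$ for all parallel $f,g$, so the joins in (U5) and in the formula $(g\diamond f)\vee f$ are defined.) *)

(* Defs.v *)
Set Implicit Arguments.
Unset Strict Implicit.
Unset Printing Implicit Defensive.

Declare Scope rcat_scope.
Delimit Scope rcat_scope with rcat.
Open Scope rcat_scope.

Reserved Notation "f ;; g" (at level 39, left associativity).

(* Composition is diagrammatic: [f ;; g] is [f] followed by [g]. *)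
Record restriction_category : Type := RestrictionCategory {
  obj :> Type;
  hom : obj -> obj -> Type;
  idm : forall A : obj, hom A A;
  comp : forall A B C : obj, hom A B -> hom B C -> hom A C
    where "f ;; g" := (comp f g) : rcat_scope;
  rst : forall A B : obj, hom A B -> hom A A;
  comp_idl : forall (A B : obj) (f : hom A B), idm A ;; f = f;
  comp_idr : forall (A B : obj) (f : hom A B), f ;; idm B = f;
  comp_assoc : forall (A B C D : obj)
      (f : hom A B) (g : hom B C) (h : hom C D),
    (f ;; g) ;; h = f ;; (g ;; h);
  rst_R1 : forall (A B : obj) (f : hom A B), rst f ;; f = f;
  rst_R2 : forall (A B C : obj) (f : hom A B) (g : hom A C),
    rst f ;; rst g = rst g ;; rst f;
  rst_R3 : forall (A B C : obj) (f : hom A B) (g : hom A C),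
    rst (rst f ;; g) = rst f ;; rst g;
  rst_R4 : forall (A B C : obj) (f : hom A B) (g : hom B C),
    f ;; rst g = rst (f ;; g) ;; f
}.

Arguments hom {r} A B.
Arguments idm {r} A.
Arguments comp {r A B C} f g.
Arguments rst {r A B} f.

Notation "f ;; g" := (comp f g) : rcat_scope.

Definition rle (X : restriction_category) (A B : X) (f g : hom A B) : Prop :=
  rst f ;; g = f.

Definition compat (X : restriction_category) (A B : X) (f g : hom A B) : Prop :=
  rst g ;; f = rst f ;; g.

Lemma compat_comp (X : restriction_category) (A' A B : X)
    (k : hom A' A) (f g : hom A B) :
  compat f g -> compat (k ;; f) (k ;; g).
Proof.
unfold compat; intros H.
rewrite <- !comp_assoc, <- !rst_R4, !comp_assoc, H.
reflexivity.
Qed.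

(* A join is only asked of a compatible pair, so the operation takes the
   compatibility proof as an argument; its value does not depend on it
   ([join_unique] below). *)
Record binary_joins (X : restriction_category) : Type := BinaryJoins {
  join : forall (A B : X) (f g : hom A B), compat f g -> hom A B;
  join_J1l : forall (A B : X) (f g : hom A B) (c : compat f g),
    rle f (join c);
  join_J1r : forall (A B : X) (f g : hom A B) (c : compat f g),
    rle g (join c);
  join_J2 : forall (A B : X) (f g : hom A B) (c : compat f g) (h : hom A B),
    rle f h -> rle g h -> rle (join c) h;
  join_J3 : forall (A' A B : X) (k : hom A' A) (f g : hom A B)
      (c : compat f g),
    k ;; join c = join (compat_comp k c)
}.

Lemma rle_antisym (X : restriction_category) (A B : X) (f g : hom A B) :
  rle f g -> rle g f -> f = g.
Proof.
unfold rle; intros Hfg Hgf.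
transitivity (rst f ;; (rst g ;; f)).
- rewrite Hgf; symmetry; exact Hfg.
- rewrite <- comp_assoc, rst_R2, comp_assoc, rst_R1; exact Hgf.
Qed.

(* Hence "X has binary joins" determines the structure [binary_joins X],
   and quantifying over that structure involves no choice. *)
Lemma join_unique (X : restriction_category) (J J' : binary_joins X)
    (A B : X) (f g : hom A B) (c c' : compat f g) :
  join J c = join J' c'.
Proof.
apply rle_antisym; apply join_J2;
  first [apply join_J1l | apply join_J1r].
Qed.

Definition hom_binop (X : restriction_category) : Type :=
  forall A B : X, hom A B -> hom A B -> hom A B.

Record override_operator (X : restriction_category) (ovr : hom_binop X)
    : Prop := OverrideOperator {
  ovr_1 : forall (A B : X) (f g h : hom A B),
    ovr A B (ovr A B f g) h = ovr A B f (ovr A B g h);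
  ovr_2 : forall (A B : X) (f g : hom A B),
    ovr A B f (rst f ;; g) = f;
  ovr_3 : forall (A B C : X) (f : hom A B) (g : hom A C),
    ovr A B (rst g ;; f) f = f;
  ovr_4 : forall (A B C : X) (f : hom A B) (g h : hom B C),
    f ;; ovr B C g h = ovr A C (f ;; g) (f ;; h);
  ovr_5 : forall (A B C : X) (f g : hom A C) (h : hom A B),
    rst (ovr A C f g) ;; h = ovr A B (rst f ;; h) (rst g ;; h)
}.

(* The joins in [upd_U5] exist only thanks to [upd_U1]-[upd_U3], so the axioms before it
   are grouped first. *)
Record update_axioms_1_4 (X : restriction_category) (upd : hom_binop X)
    : Prop := UpdateAxioms14 {
  upd_U1 : forall (A B C : X) (f : hom A B) (g h : hom B C),
    f ;; upd B C g h = upd A C (f ;; g) (f ;; h);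
  upd_U2 : forall (A B : X) (f g : hom A B),
    rst (upd A B f g) = rst f;
  upd_U3 : forall (A B : X) (f g : hom A B),
    upd A B (rst f ;; g) f = rst g ;; f;
  upd_U4 : forall (A B C D : X) (f : hom A B) (g : hom A C) (h : hom A D),
    upd A D (rst g ;; h) (rst f ;; h) = rst g ;; h
}.

Lemma upd_compat (X : restriction_category) (upd : hom_binop X)
    (U : update_axioms_1_4 upd) (A B : X) (g f : hom A B) :
  compat (upd A B g f) f.
Proof.
unfold compat.
rewrite (upd_U1 U), rst_R1, (upd_U3 U), (upd_U2 U).
reflexivity.
Qed.

Definition upd_join (X : restriction_category) (J : binary_joins X)
    (upd : hom_binop X) (U : update_axioms_1_4 upd)
    (A B : X) (g f : hom A B) : hom A B :=
  join J (upd_compat U g f).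

(* With [upd_join J U g f] standing for (g <> f) \/ f, the last axiom is
   (((h <> g) \/ g) <> f) \/ f = (h <> ((g <> f) \/ f)) \/ ((g <> f) \/ f). *)
Record update_operator (X : restriction_category) (J : binary_joins X)
    (upd : hom_binop X) : Prop := UpdateOperator {
  upd_U14 :> update_axioms_1_4 upd;
  upd_U5 : forall (A B : X) (f g h : hom A B),
    upd_join J upd_U14 (upd_join J upd_U14 h g) f
    = upd_join J upd_U14 h (upd_join J upd_U14 g f)
}.

Definition update_of_override (X : restriction_category) (ovr : hom_binop X)
    : hom_binop X :=
  fun A B f g => rst f ;; ovr A B g f.

Definition override_of_update (X : restriction_category) (J : binary_joins X)
    (upd : hom_binop X) (U : update_operator J upd) : hom_binop X :=
  fun A B f g => upd_join J U g f.

Arguments update_of_override {X} ovr A B f g.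
Arguments override_of_update {X J upd} U A B f g.

(* Main.v *)
(** From an override operator the join of a compatible pair is [f |> g] itself;
    conversely, [f |> g] is always the join of [f] and [rst g ;; (f |> g)],
    which makes the two translations inverse to each other and turns (U5) into
    associativity.  The only override axiom that needs an argument on the update
    side is (5), which by (U2) and (U4) amounts to
    [rst (f \/ g) ;; h = (rst f ;; h) \/ (rst g ;; h)]. *)

Require Import Defs.
From Stdlib Require Import Setoid.

Set Implicit Arguments.
Unset Strict Implicit.
Unset Printing Implicit Defensive.

Section RestrictionCategories.

Context (X : restriction_category).

Lemma rst_idm (A : X) : rst (idm A) = idm A.
Proof. rewrite <- (comp_idr (rst (idm A))); apply rst_R1. Qed.

Lemma rst_rst (A B : X) (f : hom A B) : rst (rst f) = rst f.
Proof.
rewrite <- (comp_idr (rst f)) at 1.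
rewrite rst_R3, rst_idm; apply comp_idr.
Qed.

Lemma rst_compCA (A B C D : X) (f : hom A B) (g : hom A C) (h : hom A D) :
  rst f ;; (rst g ;; h) = rst g ;; (rst f ;; h).
Proof. now rewrite <- !comp_assoc, (rst_R2 f g). Qed.

Lemma rst_comp_idem (A B C : X) (f : hom A B) (g : hom A C) :
  rst f ;; (rst f ;; g) = rst f ;; g.
Proof. now rewrite <- comp_assoc, <- rst_R3, rst_R1. Qed.

Lemma rle_refl (A B : X) (f : hom A B) : rle f f.
Proof. apply rst_R1. Qed.

Lemma rle_rst_comp (A B C : X) (f : hom A B) (g : hom A C) :
  rle (rst g ;; f) f.
Proof. unfold rle; now rewrite rst_R3, comp_assoc, rst_R1. Qed.

Lemma rle_rst_absorb (A B C : X) (f g : hom A B) (h : hom A C) :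
  rle f g -> rst g ;; (rst f ;; h) = rst f ;; h.
Proof.
intros H; unfold rle in H.
now rewrite <- comp_assoc, rst_R2, <- rst_R3, H.
Qed.

Lemma rle_rst_compl (A B C : X) (f g : hom A B) (h : hom A C) :
  rle f g -> rle (rst f ;; h) (rst g ;; h).
Proof.
intros H; unfold rle.
rewrite rst_R3, comp_assoc, (rst_compCA h g), rst_R1, rst_compCA.
exact (rle_rst_absorb h H).
Qed.

Section Joins.

Context (J : binary_joins X).

(** The compatibility proof depends on both operands, which blocks rewriting them in place under
    [join]. *)
Lemma join_congr (A B : X) (f f' g g' : hom A B)
    (c : compat f g) (c' : compat f' g') :
  f = f' -> g = g' -> join J c = join J c'.
Proof. intros -> ->; apply join_unique. Qed.

Lemma join_absorbl (A B : X) (f g : hom A B) (c : compat f g) :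
  rle f g -> join J c = g.
Proof.
intros H; apply rle_antisym.
- apply join_J2; [exact H | apply rle_refl].
- apply join_J1r.
Qed.

Lemma join_absorbr (A B : X) (f g : hom A B) (c : compat f g) :
  rle g f -> join J c = f.
Proof.
intros H; apply rle_antisym.
- apply join_J2; [apply rle_refl | exact H].
- apply join_J1l.
Qed.

(** The right side lies below both [h] and the left side, so only domains remain to be compared:
    within the domain of [join J c] it must be defined wherever [h] is. *)
Lemma rst_comp_join (A B C : X) (f g : hom A B) (h : hom A C)
    (c : compat f g) (d : compat (rst f ;; h) (rst g ;; h)) :
  rst (join J c) ;; h = join J d.
Proof.
set (j := join J c); set (k := join J d).
assert (Hkh : rle k h) by (apply join_J2; apply rle_rst_comp).
assert (Hkj : rle k (rst j ;; h)).
{ apply join_J2; apply rle_rst_compl; [apply join_J1l | apply join_J1r]. }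
(* Within the domain of [a], the maps [h] and [k] have the same domain: one inclusion comes from
   [rst a ;; h] lying below [k], the other from [Hkh]. *)
assert (agree : forall a : hom A B,
    rle (rst a ;; h) k -> rst h ;; a = rst k ;; a).
{ intros a Ha.
  assert (Hr : rst h ;; rst a = rst k ;; rst a).
  { transitivity (rst (rst a ;; h)); [now rewrite rst_R3, rst_R2 |].
    rewrite <- Ha, rst_R3, rst_R3.
    transitivity (rst a ;; (rst h ;; rst k)); [apply comp_assoc |].
    rewrite (rst_R2 h k), <- (rst_R3 k h), Hkh; apply rst_R2. }
  now rewrite <- (rst_R1 a), <- !comp_assoc, Hr. }
(* By (J3), [j] inherits from [f] and [g] that [rst h] and [rst k] act alike. *)
assert (Hj : rst h ;; j = rst k ;; j).
{ unfold j; rewrite !join_J3.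
  apply join_congr; apply agree; [apply join_J1l | apply join_J1r]. }
assert (Hr : rst h ;; rst j = rst k ;; rst j) by now rewrite <- !rst_R3, Hj.
rewrite <- (rst_R1 h), (rst_compCA j h), <- comp_assoc, Hr, comp_assoc.
exact Hkj.
Qed.

End Joins.

Section Override.

Context (ovr : hom_binop X) (O : override_operator ovr).

Lemma rle_ovr (A B : X) (f g : hom A B) : rle f (ovr f g).
Proof. unfold rle; rewrite (ovr_4 O), rst_R1; apply (ovr_2 O). Qed.

Lemma ovr_lub (A B : X) (f g h : hom A B) :
  rle f h -> rle g h -> rle (ovr f g) h.
Proof. unfold rle; intros Hf Hg; now rewrite (ovr_5 O), Hf, Hg. Qed.

(** Compatibility turns [rst g ;; f] into [rst f ;; g], which (3) absorbs into [g]. *)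
Lemma rle_ovr_compat (A B : X) (f g : hom A B) :
  compat f g -> rle g (ovr f g).
Proof.
unfold rle; intros c.
rewrite (ovr_4 O), rst_R1, c; apply (ovr_3 O).
Qed.

(** Axioms (5) and (4) turn the left side into a restriction of [rst g ;; h] overriding
    [rst g ;; h], where (3) applies. Thus the domain of [ovr f g] contains that of [g], even where
    [f] and [g] conflict. *)
Lemma ovr_rst_comp (A B C : X) (f g : hom A B) (h : hom A C) :
  rst g ;; (rst (ovr f g) ;; h) = rst g ;; h.
Proof.
rewrite (ovr_5 O), (ovr_4 O), rst_comp_idem, rst_compCA.
apply (ovr_3 O).
Qed.

Definition joins_of_override : binary_joins X :=
  BinaryJoins (X := X) (join := fun A B f g _ => ovr f g)
    (fun A B f g _ => rle_ovr f g)
    (fun A B f g c => rle_ovr_compat c)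
    (fun A B f g _ h => @ovr_lub A B f g h)
    (fun A' A B k f g _ => ovr_4 O k f g).

Lemma update_of_override_14 : update_axioms_1_4 (update_of_override ovr).
Proof.
unfold update_of_override; split.
- intros A B C f g h.
  now rewrite <- comp_assoc, rst_R4, comp_assoc, (ovr_4 O).
- intros A B f g.
  rewrite rst_R3, <- (comp_idr (rst (ovr g f))), ovr_rst_comp.
  apply comp_idr.
- intros A B f g.
  now rewrite (ovr_2 O), rst_R3, comp_assoc, rst_compCA, rst_R1.
- intros A B C D f g h.
  (* Axiom (5) needs parallel maps, while [f] and [g] may have different codomains; the endomaps
     [rst f] and [rst g] replace them. *)
  rewrite <- (rst_rst f), <- (rst_rst g), <- (ovr_5 O), !rst_rst.
  rewrite rst_R3, comp_assoc, (rst_compCA h), rst_R1.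
  rewrite <- (rst_rst g) at 1; rewrite ovr_rst_comp.
  now rewrite rst_rst.
Qed.

(** Both operands of the join lie below [ovr f g]. Conversely, (5) rewrites [rst (ovr f g) ;; j] as
    [f] overriding [rst g ;; ovr f g], which associativity collapses to [ovr f g]. *)
Lemma upd_join_of_override (J : binary_joins X)
    (U : update_axioms_1_4 (update_of_override ovr))
    (A B : X) (f g : hom A B) :
  upd_join J U g f = ovr f g.
Proof.
unfold upd_join; set (j := join J _).
assert (Hj : rle j (ovr f g)).
{ apply join_J2; [apply rle_rst_comp | apply rle_ovr]. }
assert (Hf : rst f ;; j = f) by apply join_J1r.
assert (Hg : rst g ;; j = update_of_override ovr A B g f).
{ rewrite <- (upd_U2 U g f); apply join_J1l. }
apply rle_antisym; [exact Hj |]; unfold rle.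
rewrite (ovr_5 O), Hf, Hg; unfold update_of_override.
rewrite (ovr_4 O), rst_R1, <- (ovr_1 O).
(* [rst g ;; f] lies below [f], so [f] overrides it by (2). *)
rewrite <- (rst_R1 f) at 2.
now rewrite rst_compCA, (ovr_2 O).
Qed.

Lemma update_of_override_operator (J : binary_joins X) :
  update_operator J (update_of_override ovr).
Proof.
exists update_of_override_14; intros A B f g h.
rewrite !upd_join_of_override; symmetry; apply (ovr_1 O).
Qed.

End Override.

Section Update.

Context (J : binary_joins X) (upd : hom_binop X) (U : update_operator J upd).

Lemma override_of_update_operator : override_operator (override_of_update U).
Proof.
unfold override_of_update; split.
- intros A B f g h; symmetry; apply (upd_U5 U).
- intros A B f g; apply join_absorbl.
  rewrite (upd_U3 U); apply rle_rst_comp.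
- intros A B C f g; unfold upd_join.
  (* This is (U4) with [f] written as [rst f ;; f]. *)
  assert (E : upd f (rst g ;; f) = f).
  { rewrite <- (rst_R1 f) at 1; rewrite (upd_U4 U); apply rst_R1. }
  rewrite join_absorbr; rewrite E; [reflexivity | apply rle_rst_comp].
- intros A B C f g h; unfold upd_join; rewrite join_J3.
  apply join_congr; [apply (upd_U1 U) | reflexivity].
- intros A B C f g h; unfold upd_join.
  (* Both sides equal [rst g ;; h]; the equation also transports compatibility to the restricted
     maps. *)
  assert (E : rst (upd g f) ;; h = upd (rst g ;; h) (rst f ;; h)).
  { now rewrite (upd_U2 U), (upd_U4 U). }
  assert (d : compat (rst (upd g f) ;; h) (rst f ;; h)).
  { rewrite E; apply (upd_compat U). }
  rewrite (rst_comp_join _ _ d).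
  now apply join_congr.
Qed.

(** By (U2), [rst f] is the domain of [upd f g], and restricting a join to the domain of one operand
    returns that operand. *)
Lemma update_of_override_of_update (A B : X) (f g : hom A B) :
  update_of_override (override_of_update U) A B f g = upd f g.
Proof.
unfold update_of_override, override_of_update.
rewrite <- (upd_U2 U f g); apply join_J1l.
Qed.

End Update.

End RestrictionCategories.

Theorem theorem34 (X : restriction_category) :
  (forall ovr : hom_binop X, override_operator ovr ->
     exists J : binary_joins X, update_operator J (update_of_override ovr))
  /\ (forall (J : binary_joins X) (upd : hom_binop X)
        (U : update_operator J upd),
        override_operator (override_of_update U))
  /\ (forall ovr : hom_binop X, override_operator ovr ->
        forall (J : binary_joins X)
          (U : update_operator J (update_of_override ovr))
          (A B : X) (f g : hom A B),
          override_of_update U A B f g = ovr A B f g)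
  /\ (forall (J : binary_joins X) (upd : hom_binop X)
        (U : update_operator J upd) (A B : X) (f g : hom A B),
        update_of_override (override_of_update U) A B f g = upd A B f g).
Proof.
split; [| split; [| split]].
- intros ovr O; exists (joins_of_override O).
  apply (update_of_override_operator O).
- apply override_of_update_operator.
- intros ovr O J U A B f g; apply (upd_join_of_override O).
- apply update_of_override_of_update.
Qed.
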